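(* Let $\tau(t)$, $t\in\mathbb C^\infty$, be an arbitrary KdV tau function. Then: (i) for every $z_1,z_2\in\mathbb C$, $$(z_2-z_1)\Bigl[\tau(t+[z_1]+[z_2])\,\tau(t-[z_1])\,\tau(t-[z_2])-\tau(t-[z_1]-[z_2])\,\tau(t+[z_1])\,\tau(t+[z_2])\Bigr]$$ $$=(z_2+z_1)\Bigl[\tau(t+[z_1]-[z_2])\,\tau(t-[z_1])\,\tau(t+[z_2])-\tau(t-[z_1]+[z_2])\,\tau(t+[z_1])\,\tau(t-[z_2])\Bigr];$$ (ii) for every $z\in\mathbb C$, $$\tau(t+2[z])\,\tau^2(t-[z])-\tau(t-2[z])\,\tau^2(t+[z])=2\sum_{k=0}^\infty z^{2k+1}\Bigl[\tau(t-[z])\,W_{2k+1}\bigl(\tau(t),\tau(t+[z])\bigr)+\tau(t+[z])\,W_{2k+1}\bigl(\tau(t),\tau(t-[z])\bigr)\Bigr],$$ where $W_{2k+1}(f,g):=f\,(\partial_{t_{2k+1}}g)-(\partial_{t_{2k+1}}f)\,g$ for $k=0,1,2,\dots$.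
   Context: Notation: $t=(t_1,t_2,t_3,\dots)\in\mathbb C^\infty$, $x\equiv t_1$. For $z\in\mathbb C$, $[z]:=(z,z^2/2,z^3/3,\dots)\in\mathbb C^\infty$, so $\tau(t\pm[z])=\tau(t_1\pm z,t_2\pm z^2/2,t_3\pm z^3/3,\dots)$, and $2[z]=[z]+[z]$. A KdV tau function is a (not identically zero) tau function of the Kadomtsev–Petviashvili (KP) hierarchy with $\partial_{t_{2k}}\tau=0$ for $k=1,2,3,\dots$; consequently $\tau(t-[z])=\tau(t+[-z])$ for all $z$. Here a KP tau function has its standard meaning (the Hirota bilinear identity: the coefficient of $z^{-1}$ in $\exp(\sum_{k\ge1}(t_k-t_k')z^k)\,\tau(t-[z^{-1}])\,\tau(t'+[z^{-1}])$ vanishes for all $t,t'$). It is a known fact that every KP tau function satisfies the Fay identity: for all $z_0,z_1,z_2,z_3$, $$(z_0-z_1)(z_2-z_3)\tau(t+[z_0]+[z_1])\tau(t+[z_2]+[z_3])+(z_0-z_2)(z_3-z_1)\tau(t+[z_0]+[z_2])\tau(t+[z_3]+[z_1])+(z_0-z_3)(z_1-z_2)\tau(t+[z_0]+[z_3])\tau(t+[z_1]+[z_2])=0.$$ Conventions: $\tau$ is regular enough (e.g. polynomial, analytic, or a formal power series with the $z$'s treated accordingly) that the partial derivatives exist and shifts are differentiated by the chain rule $\partial_z\,\tau(t+[z])=\sum_{k\ge1}z^{k-1}(\partial_{t_k}\tau)(t+[z])$. Identities are understood where the expressions are defined. *)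

(* Defs.v *)
From HB Require Import structures.
From mathcomp Require Import all_boot all_order all_algebra.
From mathcomp Require Import finmap monalg.
From mathcomp Require Import complex.
From mathcomp Require Import boolp classical_sets functions reals.
From mathcomp Require Import topology normedtype sequences.

Set Implicit Arguments.
Unset Strict Implicit.
Unset Printing Implicit Defensive.

Import Order.TTheory GRing.Theory Num.Theory.
Import numFieldNormedType.Exports.

Local Open Scope classical_set_scope.
Local Open Scope ring_scope.

(* The times t_1, t_2, ... are indexed from 0: a point t : nat -> A of A^oo has
   t i = t_{i+1}, and index i carries the weight i + 1. *)

(** ** The ring A[[lambda]] *)

(* [f n] is the coefficient of lambda^n. *)
Definition fps (A : Type) : Type := nat -> A.

HB.instance Definition _ (A : Type) := gen_eqMixin (fps A).
HB.instance Definition _ (A : Type) := gen_choiceMixin (fps A).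

Section FpsRing.
Variable A : comNzRingType.
Implicit Types f g h : fps A.

Definition fps_zero : fps A := fun=> 0.
Definition fps_opp f : fps A := fun n => - f n.
Definition fps_add f g : fps A := fun n => f n + g n.
Definition fps_one : fps A := fun n => (n == 0%N)%:R.
Definition fps_mul f g : fps A := fun n => \sum_(i < n.+1) f i * g (n - i)%N.

Fact fps_addA : associative fps_add.
Proof. by move=> f g h; apply/funext => n; rewrite /fps_add addrA. Qed.
Fact fps_addC : commutative fps_add.
Proof. by move=> f g; apply/funext => n; rewrite /fps_add addrC. Qed.
Fact fps_add0 : left_id fps_zero fps_add.
Proof. by move=> f; apply/funext => n; rewrite /fps_add add0r. Qed.
Fact fps_addN : left_inverse fps_zero fps_opp fps_add.
Proof. by move=> f; apply/funext => n; rewrite /fps_add addNr. Qed.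

HB.instance Definition _ := GRing.isZmodule.Build (fps A)
  fps_addA fps_addC fps_add0 fps_addN.

Definition fps_trunc (N : nat) f : {poly A} := \poly_(i < N) f i.

Fact fps_mul_trunc N f g n : (n < N)%N ->
  fps_mul f g n = (fps_trunc N f * fps_trunc N g)`_n.
Proof.
move=> nN; rewrite coefM; apply: eq_bigr => i _.
have iN : (i < N)%N by apply: leq_trans nN; rewrite ltnS -ltnS ltn_ord.
by rewrite !coef_poly iN (leq_ltn_trans (leq_subr _ _) nN).
Qed.

Fact fps_mulC : commutative fps_mul.
Proof.
by move=> f g; apply/funext => n; rewrite !(@fps_mul_trunc n.+1) // mulrC.
Qed.

Fact fps_mulA : associative fps_mul.
Proof.
move=> f g h; apply/funext => n.
have tr (a b : fps A) (m : nat) : (m < n.+1)%N ->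
    (fps_trunc n.+1 (fps_mul a b))`_m = (fps_trunc n.+1 a * fps_trunc n.+1 b)`_m.
  by move=> mn; rewrite coef_poly mn (@fps_mul_trunc n.+1).
rewrite !(@fps_mul_trunc n.+1) //.
transitivity ((fps_trunc n.+1 f * (fps_trunc n.+1 g * fps_trunc n.+1 h))`_n).
  by rewrite !coefM; apply: eq_bigr => i _; rewrite tr // ltnS leq_subr.
rewrite mulrA !coefM; apply: eq_bigr => i _; congr (_ * _).
by rewrite tr.
Qed.

Fact fps_mul1 : left_id fps_one fps_mul.
Proof.
move=> f; apply/funext => n; rewrite /fps_mul big_ord_recl /= mul1r subn0.
by rewrite big1 ?addr0 // => i _; rewrite /fps_one mul0r.
Qed.

Fact fps_mulD : left_distributive fps_mul fps_add.
Proof.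
move=> f g h; apply/funext => n; rewrite /fps_add /fps_mul -big_split /=.
by apply: eq_bigr => i _; rewrite mulrDl.
Qed.

Fact fps_one_neq0 : fps_one != 0 :> fps A.
Proof.
by apply/eqP => /(congr1 (fun f : fps A => f 0%N)) /eqP; rewrite oner_eq0.
Qed.

HB.instance Definition _ := GRing.Zmodule_isComNzRing.Build (fps A)
  fps_mulA fps_mulC fps_mul1 fps_mulD fps_one_neq0.

(* lambda * z *)
Definition lam (z : A) : fps A := fun n => if n == 1%N then z else 0.

(* \sum_(k >= 0) g k, for a family with lambda^k | g k for every k: the terms
   with k > n then do not contribute to the coefficient of lambda^n. *)
Definition fps_sum (g : nat -> fps A) : fps A :=
  fun n => \sum_(k < n.+1) g k n.

End FpsRing.

(** ** Formal power series in t_1, t_2, ... *)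

(* The coefficient function on the monomials in infinitely many variables. *)
Definition tseries (A : Type) : Type := {cmonom nat} -> A.

Definition expmon (n : nat) (a : {ffun 'I_n -> 'I_n.+1}) : {cmonom nat} :=
  \big[mmul/mone]_(i < n) expcmn (ucm (val i)) (a i).

(* f(lambda s_1, lambda^2 s_2, lambda^3 s_3, ...) in A[[lambda]].  Its
   coefficient of lambda^n is the part of f of weight n evaluated at s, a
   polynomial in s_1, ..., s_n in which no exponent exceeds n.

   The dilation t_k -> lambda^k t_k, z -> lambda z sends [z] to the dilation of
   [z], so it turns an identity between formal power series in the t_k and z
   into one in A[[lambda]] for each choice of values of the t_k and z.  The
   coefficients of lambda^n being polynomials in these values, an identity
   between formal power series over an infinite field is the same thing as the
   dilated identity for all values. *)
Definition dil (A : comNzRingType) (f : tseries A) (s : nat -> A) : fps A :=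
  fun n => \sum_(a : {ffun 'I_n -> 'I_n.+1} | (\sum_(i < n) i.+1 * a i == n)%N)
             f (expmon a) * \prod_(i < n) s i ^+ a i.

(* The derivative with respect to t_{i+1}. *)
Definition tderiv (A : comNzRingType) (i : nat) (f : tseries A) : tseries A :=
  fun m => f (mmul m (ucm i)) *+ (m i).+1.

(* [z] = (z, z^2/2, z^3/3, ...) *)
Definition miwa (A : unitRingType) (z : A) : nat -> A :=
  fun i => z ^+ i.+1 / i.+1%:R.

(** ** Tau functions *)

Section Tau.
Variable K : fieldType.
Implicit Types (tau : tseries K) (t : nat -> K).

(* The coefficient of z^n in exp(\sum_(k >= 1) t_k z^k): only t_1, ..., t_n and
   the powers up to n of the exponent contribute. *)
Definition exp_coef t (n : nat) : K :=
  (\sum_(j < n.+1) (j`!%:R)^-1 *: (\sum_(k < n) t k *: 'X^(k.+1)) ^+ j)`_n.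

(* The dilated Hirota identity, for z -> lambda^-1 z, which leaves the
   exponential unchanged: with w = z^-1, the coefficient of lambda^N in
   tau(t - [z^-1]) tau(t' + [z^-1]) is the polynomial P in w (the variable 'X),
   and the sum is the coefficient of z^-1 in exp(\sum_k (t_k - t'_k) z^k) P. *)
Definition hirota tau : Prop :=
  forall (t t' : nat -> K) (N : nat),
    let ptau : tseries {poly K} := polyC \o tau in
    let P : {poly K} :=
      (dil ptau ((polyC \o t) - miwa 'X) * dil ptau ((polyC \o t') + miwa 'X)) N in
    \sum_(n < size P) exp_coef (t - t') n * P`_n.+1 = 0.

Definition KP_tau tau : Prop := (exists m, tau m != 0) /\ hirota tau.

Definition KdV_tau tau : Prop :=
  KP_tau tau /\ forall (k : nat) m, tderiv k.*2.+1 tau m = 0.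

(* W_j(f, g) for j = i + 1, f(t) = tau(s) and g(t) = tau(s') where s and s' are
   translates of t by constant vectors; [ev] is the way of evaluating series,
   either [dil] or [tvalue]. *)
Definition W (V : pzRingType) (ev : tseries K -> (nat -> K) -> V)
    (i : nat) tau (s s' : nat -> K) : V :=
  ev tau s * ev (tderiv i tau) s' - ev (tderiv i tau) s * ev tau s'.

End Tau.

(** ** Values at points of K^oo *)

(* The series is summed by weight, i.e., lambda is set to 1.  For a polynomial
   this is the usual value and the convergence condition always holds. *)
Definition tabs_cvg (K : numFieldType) (f : tseries K) (s : nat -> K) : Prop :=
  cvgn [normed series (dil f s : nat -> K)].

Definition tvalue (K : numFieldType) (f : tseries K) (s : nat -> K) : K :=
  limn (series (dil f s : nat -> K)).

Definition tvalue_abs (K : numFieldType) (f : tseries K) (s : nat -> K) : K :=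
  limn [normed series (dil f s : nat -> K)].

(* Absolute convergence of \sum_k z^{2k+1} (d tau / d t_{2k+1})(s). *)
Definition tderiv_abs_cvg (K : numFieldType) (tau : tseries K) (z : K)
    (s : nat -> K) : Prop :=
  (forall k, tabs_cvg (tderiv k.*2 tau) s) /\
  cvgn (series (fun k => `|z| ^+ k.*2.+1 * tvalue_abs (tderiv k.*2 tau) s)).

(* Main.v *)
(* Taking t - t' = [a] + [b] + [-a] in the Hirota identity, the exponential is
   1 / ((1 - a z) (1 - b z) (1 + a z)), and the coefficient of z^-1 is a sum of three
   residues.  As tau only depends on the odd times, [a] + [-a] drops out and this is
     (a + b) tau(t - [a] + [b]) tau(t + [a]) - 2 b tau(t) tau(t + [b])
       + (b - a) tau(t + [a] + [b]) tau(t - [a]) = 0.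
   Identity (i) is the combination of this relation, multiplied by tau(t - [b]), with
   the one for (- a, - b), multiplied by tau(t + [b]): the terms in tau(t) cancel.
   Identity (ii) is obtained in the same way from b = a, where the double pole
   produces the derivatives of tau.  The numerical identities follow by setting
   lambda = 1, which is compatible with Cauchy products and with the sum over k by
   Tannery's theorem. *)

Require Import Defs.
From HB Require Import structures.
From mathcomp Require Import all_boot all_order all_algebra.
From mathcomp Require Import finmap monalg.
From mathcomp Require Import complex.
From mathcomp Require Import boolp classical_sets functions reals.
From mathcomp Require Import topology normedtype sequences.
From mathcomp Require Import ring zify lra.

Import Order.TTheory GRing.Theory Num.Theory.
Import numFieldNormedType.Exports.

Local Open Scope classical_set_scope.
Local Open Scope ring_scope.

Set Implicit Arguments.
Unset Strict Implicit.
Unset Printing Implicit Defensive.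

(** * Power series in lambda *)

Lemma fpsM (A : comNzRingType) (f g : fps A) n :
  (f * g) n = \sum_(i < n.+1) f i * g (n - i)%N.
Proof. by []. Qed.

Lemma fpsD (A : comNzRingType) (f g : fps A) n : (f + g) n = f n + g n.
Proof. by []. Qed.

Lemma fpsN (A : comNzRingType) (f : fps A) n : (- f) n = - f n.
Proof. by []. Qed.

Lemma fpsB (A : comNzRingType) (f g : fps A) n : (f - g) n = f n - g n.
Proof. by []. Qed.

Lemma fps1 (A : comNzRingType) n : (1 : fps A) n = (n == 0%N)%:R.
Proof. by []. Qed.

Lemma fps_lamM (A : comNzRingType) (z : A) (f : fps A) n :
  (lam z * f) n = if n is m.+1 then z * f m else 0.
Proof.
rewrite fpsM.
case: n => [|n]; first by rewrite big_ord1 mul0r.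
rewrite big_ord_recl big_ord_recl mul0r add0r /= subSS subn0 big1 ?addr0 //.
by move=> i _; rewrite mul0r.
Qed.

Lemma lamN (A : comNzRingType) (a : A) : lam (- a) = - lam a.
Proof. by apply/funext => -[|[|n]] //; rewrite [RHS]oppr0. Qed.

(** The product calls [fps_sum g] in degrees n - i, where it stops at k = n - i; divisibility of
    [g k] by $\lambda^k$ extends all these ranges to k <= n. *)
Lemma fps_sumMl (A : comNzRingType) (f : fps A) (g : nat -> fps A) :
    (forall k n, (n < k)%N -> g k n = 0) ->
  fps_sum (fun k => f * g k) = f * fps_sum g.
Proof.
move=> g0; apply/funext => n; rewrite /fps_sum.
under eq_bigr do rewrite fpsM.
rewrite exchange_big fpsM.
apply: eq_bigr => i _; rewrite mulr_sumr.
rewrite [RHS](big_ord_widen n.+1 (fun k => f i * g k (n - i)%N)) ?ltnS ?leq_subr //.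
rewrite [RHS]big_mkcond; apply: eq_bigr => k _; case: ifP => // /negbT.
by rewrite -leqNgt => ki; rewrite g0 ?mulr0.
Qed.

Lemma fps_sumD (A : comNzRingType) (g h : nat -> fps A) :
  fps_sum (fun k => g k + h k) = fps_sum g + fps_sum h.
Proof. by apply/funext => n; rewrite fpsD -big_split. Qed.

Definition fps_deriv (A : comNzRingType) (f : fps A) : fps A :=
  fun n => f n.+1 *+ n.+1.

Lemma fps_derivM (A : comNzRingType) (f g : fps A) :
  fps_deriv (f * g) = fps_deriv f * g + f * fps_deriv g.
Proof.
apply/funext => n; rewrite /fps_deriv.
rewrite [X in X *+ _](@fps_mul_trunc A n.+2) // -coef_deriv derivM coefD !coefM.
have le (i : 'I_n.+1) : (i < n.+2)%N by rewrite ltnS ltnW.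
have leB (i : 'I_n.+1) : (n - i < n.+2)%N.
  by apply: leq_ltn_trans (leq_subr _ _) _.
have ltB (i : 'I_n.+1) : (n - i < n.+1)%N by rewrite ltnS leq_subr.
congr (_ + _); apply: eq_bigr => i _.
  by rewrite coef_deriv !coef_poly leB ltnS ltn_ord.
by rewrite coef_deriv !coef_poly le ltnS ltB.
Qed.

Lemma fps_derivX (A : comNzRingType) (f : fps A) j :
  fps_deriv (f ^+ j.+1) = fps_deriv f * f ^+ j *+ j.+1.
Proof.
elim: j => [|j IH]; first by rewrite expr0 mulr1.
rewrite exprS fps_derivM IH mulrnAr mulrCA -exprS -[X in X + _]mulr1n.
by rewrite -mulrnDr add1n.
Qed.

Lemma fps_deriv_lam (A : comNzRingType) (a : A) n :
  fps_deriv (1 - lam a) n = if n == 0%N then - a else 0.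
Proof.
rewrite /fps_deriv fpsB fps1.
by case: n => [|n] /=; rewrite ?subr0 ?sub0r ?mul0rn // mulr1n.
Qed.

Lemma fps_expr_lt (A : comNzRingType) (q : fps A) j n :
  q 0%N = 0 -> (n < j)%N -> (q ^+ j) n = 0.
Proof.
move=> q0; elim: j n => // j IH n nj; rewrite exprS.
apply: big1 => -[[|i] /= iP] _; first by rewrite q0 mul0r.
by rewrite IH ?mulr0 //; lia.
Qed.

Lemma coef_exp_fps (A : comNzRingType) (p : {poly A}) (f : fps A) n j :
    (forall i, (i <= n)%N -> p`_i = f i) ->
  forall i, (i <= n)%N -> (p ^+ j)`_i = (f ^+ j) i.
Proof.
move=> pf; elim: j => [|j IH] i i_n; first by rewrite !expr0 coef1.
rewrite !exprS coefM; apply: eq_bigr => -[k kP] _ /=.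
by rewrite pf ?IH //; lia.
Qed.

(** The equation gives n + 1 times coefficient n + 1 of f in terms of earlier ones. This uniqueness
    in characteristic zero yields the identities for the exponential. *)
Lemma fps_ode0 (K : numFieldType) (f g : fps K) :
  fps_deriv f = g * f -> f 0%N = 0 -> f = 0.
Proof.
move=> Df f0; apply/funext => n.
elim/ltn_ind: n => -[//|n] IH; apply/eqP; rewrite -[_ == _](mulrn_eq0 _ n.+1).
rewrite -[X in X == _]/(fps_deriv f n) Df; apply/eqP/big1 => i _.
by rewrite IH ?mulr0 // ltnS leq_subr.
Qed.

(** * The exponential $\exp(\sum_k t_k\lambda^k)$ and its values at Miwa shifts *)

Section ExpCoef.
Variable K : numFieldType.
Implicit Types (t : nat -> K) (a : K).

Definition exp_fps t : fps K := fun n => exp_coef t n.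

Let arg t : fps K := fun n => if n is k.+1 then t k else 0.

(** The exponent [arg t] has no constant term, so its j-th power starts in degree j. The freedom in
    J lets one cut-off serve several coefficients. *)
Lemma exp_fpsE t n J : (n < J)%N ->
  exp_fps t n = \sum_(j < J) (j`!%:R)^-1 * (arg t ^+ j) n.
Proof.
move=> nJ; rewrite /exp_fps /exp_coef coef_sum.
transitivity (\sum_(j < n.+1) (j`!%:R)^-1 * (arg t ^+ j) n).
  apply: eq_bigr => j _; rewrite coefZ; congr (_ * _).
  apply: (@coef_exp_fps _ _ _ n) => // i i_n.
  rewrite coef_sum; case: i i_n => [|i] i_n /=.
    by apply: big1 => k _; rewrite coefZ coefXn mulr0.
  rewrite (bigD1 (Ordinal i_n)) //= coefZ coefXn eqxx mulr1.
  rewrite big1 ?addr0 // => k; rewrite -val_eqE /= eq_sym => /negPf ki.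
  by rewrite coefZ coefXn eqSS ki mulr0.
rewrite (big_ord_widen J (fun j => (j`!%:R)^-1 * (arg t ^+ j) n)) //.
rewrite [LHS]big_mkcond; apply: eq_bigr => j _; case: ifP => // /negbT.
by rewrite -leqNgt => nj; rewrite fps_expr_lt ?mulr0.
Qed.

Let darg t : fps K := fun n => t n *+ n.+1.

(** Termwise differentiation: [darg t] is the derivative of [arg t], the term j = 0 disappears, and
    (j + 1) / (j + 1)! = 1 / j!. *)
Lemma exp_fps_deriv t : fps_deriv (exp_fps t) = darg t * exp_fps t.
Proof.
apply/funext => n; rewrite /fps_deriv (@exp_fpsE t n.+1 n.+2) //.
rewrite big_ord_recl expr0 [X in _ * X]/(0 : K) mulr0 add0r -sumrMnl.
transitivity (\sum_(j < n.+1)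
    \sum_(i < n.+1) t i *+ i.+1 * ((j`!%:R)^-1 * (arg t ^+ j) (n - i)%N)).
  apply: eq_bigr => j _; rewrite -mulrnAr -[X in _ * X]/(fps_deriv (_ ^+ _) n).
  rewrite fps_derivX.
  have -> (f : fps K) k : (f *+ k) n = f n *+ k.
    by elim: k => // k IH; rewrite !mulrS -IH.
  have cancel (x : K) : ((j.+1)`!%:R)^-1 * (x *+ j.+1) = (j`!%:R)^-1 * x.
    by rewrite factS natrM invfM -[x *+ _]mulr_natl mulrA [X in X * x]mulrAC
       mulVf ?pnatr_eq0 // mul1r.
  by rewrite cancel fpsM mulr_sumr; apply: eq_bigr => i _; rewrite mulrCA.
rewrite exchange_big fpsM; apply: eq_bigr => i _ /=.
by rewrite (@exp_fpsE t _ n.+1) ?ltnS ?leq_subr // mulr_sumr.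
Qed.

Lemma exp_fps0 t : exp_fps t 0%N = 1.
Proof. by rewrite (@exp_fpsE t _ 1) // big_ord1 expr0 invr1 mul1r. Qed.

(** Both sides solve y' = [darg (t + t')] y with y(0) = 1. *)
Lemma exp_fpsD t t' : exp_fps (t + t') = exp_fps t * exp_fps t'.
Proof.
apply/eqP; rewrite -subr_eq0; apply/eqP; apply: (@fps_ode0 _ _ (darg (t + t'))).
  have fps_derivB (f g : fps K) : fps_deriv (f - g) = fps_deriv f - fps_deriv g.
    by apply/funext => n; rewrite fpsB /fps_deriv fpsB mulrnBl.
  rewrite fps_derivB fps_derivM !exp_fps_deriv.
  have -> : darg (t + t') = darg t + darg t'.
    by apply/funext => n; rewrite fpsD /darg -mulrnDl.
  ring.
by rewrite fpsB fpsM big_ord1 !exp_fps0 mulr1 subrr.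
Qed.

(** This is $\exp(\sum_k a^k\lambda^k/k) = 1/(1 - a\lambda)$: the product has derivative zero and
    constant term 1. *)
Lemma exp_fps_miwa a : (1 - lam a) * exp_fps (miwa a) = 1.
Proof.
apply/eqP; rewrite -subr_eq0; apply/eqP; apply: (@fps_ode0 _ _ 0); last first.
  by rewrite fpsB fpsM big_ord1 exp_fps0 mulr1 fpsB fps1 subr0 subrr.
have -> : fps_deriv ((1 - lam a) * exp_fps (miwa a) - 1)
    = fps_deriv ((1 - lam a) * exp_fps (miwa a)).
  by apply/funext => n; rewrite /fps_deriv fpsB fps1 subr0.
rewrite fps_derivM exp_fps_deriv mulrA -mulrDl mul0r.
rewrite (_ : _ + _ = 0) ?mul0r //; apply/funext => n.
rewrite fpsD fps_deriv_lam mulrBl mul1r fpsB fps_lamM.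
have E k : darg (miwa a) k = a ^+ k.+1.
  by rewrite -[LHS]mulr_natr divfK // pnatr_eq0.
case: n => [|n] /=; rewrite !E; first by rewrite expr1 subr0 addNr.
by rewrite -exprS subrr addr0.
Qed.

Lemma exp_fps_miwaE a : exp_fps (miwa a) = fun n => a ^+ n.
Proof.
have Ha : (1 - lam a) * ((fun n => a ^+ n) : fps K) = 1.
  apply/funext => -[|n]; rewrite mulrBl mul1r fpsB fps_lamM fps1 ?subr0 ?expr0 //.
  by rewrite -exprS subrr.
by rewrite -[LHS]mul1r -Ha mulrAC exp_fps_miwa mul1r.
Qed.

End ExpCoef.

(** * Residues of the Hirota kernel *)

Section Residues.
Variable K : numFieldType.
Implicit Types (P : {poly K}) (a b : K).

Let geom a : fps K := fun n => a ^+ n.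

Let geomE a : (1 - lam a) * geom a = 1.
Proof. by rewrite -[geom a]exp_fps_miwaE exp_fps_miwa. Qed.

Let hornerS P a : P.[a] = P`_0 + \sum_(n < size P) P`_n.+1 * a ^+ n.+1.
Proof.
rewrite (@horner_coef_wide _ (size P).+1) ?leqnSn // big_ord_recl expr0 mulr1.
by [].
Qed.

(* exp_coef gives here the complete symmetric polynomials h_n(a, b, - a), and the
   right hand side is, up to denominators, the sum over its poles w = a, b, - a
   of the residues of P(w) w / ((w - a) (w - b) (w + a)). *)
Lemma exp_coef_residue3 a b P :
  2%:R * (a ^+ 2 - b ^+ 2) *
    (\sum_(n < size P) exp_coef (miwa a + miwa b + miwa (- a)) n * P`_n.+1)
  = (a + b) * P.[a] - 2%:R * b * P.[b] + (b - a) * P.[- a].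
Proof.
pose h := exp_fps (miwa a + miwa b + miwa (- a)).
have hE n : 2%:R * (a ^+ 2 - b ^+ 2) * h n
    = (a + b) * a ^+ n.+1 - 2%:R * b * b ^+ n.+1 + (b - a) * (- a) ^+ n.+1.
  pose u := lam a; pose v := lam b.
  have Ga : (1 - u) * geom a = 1 by exact: geomE.
  have Gb : (1 - v) * geom b = 1 by exact: geomE.
  have Gc : (1 + u) * geom (- a) = 1 by have := geomE (- a); rewrite lamN opprK.
  (* The partial fraction decomposition of h, multiplied by 2 (u^2 - v^2). Factors 2 are spelled out
     as sums, so that coefficients can be read off with [fpsD], [fpsN] and [fps_lamM]. *)
  have : u * (u * h) + u * (u * h) - (v * (v * h) + v * (v * h))
      = u * (u * geom a) + v * (u * geom a) - (v * (v * geom b) + v * (v * geom b))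
        + (u * (u * geom (- a)) - v * (u * geom (- a))).
    rewrite /h !exp_fpsD !exp_fps_miwaE -/(geom a) -/(geom b) -/(geom (- a)).
    (* Each term is multiplied by the factors equal to 1 that it lacks, so that all terms share
       [geom a], [geom b] and [geom (- a)]. *)
    have -> : u * (u * geom a) + v * (u * geom a)
        = (u * (u * geom a) + v * (u * geom a))
          * ((1 - v) * geom b) * ((1 + u) * geom (- a)).
      by rewrite Gb Gc !mulr1.
    have -> : v * (v * geom b) + v * (v * geom b)
        = (v * (v * geom b) + v * (v * geom b))
          * ((1 - u) * geom a) * ((1 + u) * geom (- a)).
      by rewrite Ga Gc !mulr1.
    have -> : u * (u * geom (- a)) - v * (u * geom (- a))
        = (u * (u * geom (- a)) - v * (u * geom (- a)))
          * ((1 - u) * geom a) * ((1 - v) * geom b).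
      by rewrite Ga Gb !mulr1.
    ring.
  move=> /(congr1 (fun f : fps K => f n.+2)) E.
  rewrite !(fpsD, fpsN) !fps_lamM /geom in E.
  have -> : 2%:R * (a ^+ 2 - b ^+ 2) * h n
    = a * (a * h n) + a * (a * h n) - (b * (b * h n) + b * (b * h n)) by ring.
  rewrite E !exprS; ring.
rewrite mulr_sumr !hornerS.
transitivity (\sum_(n < size P) P`_n.+1 *
    ((a + b) * a ^+ n.+1 - 2%:R * b * b ^+ n.+1 + (b - a) * (- a) ^+ n.+1)).
  by apply: eq_bigr => n _; rewrite -hE mulrA mulrC.
under eq_bigr do rewrite mulrDr mulrBr !(mulrCA P`__).
rewrite big_split sumrB /= -!mulr_sumr; ring.
Qed.

(* The case of a double pole, b = a. *)
Lemma exp_coef_residue2 a P :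
  - 4%:R * a *
    (\sum_(n < size P) exp_coef (miwa a + miwa a + miwa (- a)) n * P`_n.+1)
  = P.[- a] - P.[a] - 2%:R * a * P^`().[a].
Proof.
pose h := exp_fps (miwa a + miwa a + miwa (- a)).
pose geom2 : fps K := fun n => a ^+ n *+ n.+1.
have hE n : - 4%:R * a * h n
    = (- a) ^+ n.+1 - a ^+ n.+1 - 2%:R * a * (a ^+ n *+ n.+1).
  pose u := lam a.
  have Ga : (1 - u) * geom a = 1 by exact: geomE.
  have Gc : (1 + u) * geom (- a) = 1 by have := geomE (- a); rewrite lamN opprK.
  (* The double pole: $1/(1 - a\lambda)^2 = \sum_n (n+1)a^n\lambda^n$, whose coefficients produce
     P'(a). *)
  have G2 : geom2 = geom a * geom a.
    apply/funext => k; rewrite fpsM /geom /geom2.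
    rewrite (eq_bigr (fun=> a ^+ k)) ?sumr_const ?card_ord // => i _.
    by rewrite -exprD subnKC // -ltnS.
  have : - (u * h + u * h + u * h + u * h)
      = - (u * geom (- a)) - u * geom a - (u * geom2 + u * geom2).
    rewrite /h !exp_fpsD !exp_fps_miwaE -/(geom a) -/(geom (- a)) G2.
    have -> : u * geom (- a) = u * geom (- a) * ((1 - u) * geom a) * ((1 - u) * geom a).
      by rewrite Ga !mulr1.
    have -> : u * geom a = u * geom a * ((1 - u) * geom a) * ((1 + u) * geom (- a)).
      by rewrite Ga Gc !mulr1.
    have -> : u * (geom a * geom a) = u * (geom a * geom a) * ((1 + u) * geom (- a)).
      by rewrite Gc !mulr1.
    ring.
  move=> /(congr1 (fun f : fps K => f n.+1)) E.
  rewrite !(fpsD, fpsN) !fps_lamM /geom /geom2 in E.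
  have -> : - 4%:R * a * h n = - (a * h n + a * h n + a * h n + a * h n) by ring.
  rewrite E !exprS; ring.
have -> : P^`().[a] = \sum_(n < size P) P`_n.+1 * (a ^+ n *+ n.+1).
  rewrite (@horner_coef_wide _ (size P)) ?(leq_trans (size_poly _ _)) ?leq_pred //.
  by apply: eq_bigr => n _; rewrite coef_deriv mulrnAl mulrnAr.
rewrite mulr_sumr !hornerS.
transitivity (\sum_(n < size P) P`_n.+1 *
    ((- a) ^+ n.+1 - a ^+ n.+1 - 2%:R * a * (a ^+ n *+ n.+1))).
  by apply: eq_bigr => n _; rewrite -hE mulrA mulrC.
under eq_bigr do rewrite !mulrBr (mulrCA P`__ (2%:R * a)).
rewrite !sumrB -!mulr_sumr; ring.
Qed.

End Residues.

(** * Dilation as a sum over monomials *)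

Section Monomials.
Implicit Types (m : {cmonom nat}) (i j : nat).

Lemma expcmn_ucm i k j : expcmn (ucm i) k j = ((i == j) * k)%N.
Proof.
rewrite /expcmn; case: k => [|k]; first by rewrite onecmE muln0.
elim: k => [|k IH]; first by rewrite ucmE muln1.
by rewrite iteropS /= mulcmE ucmE; move: IH; rewrite iteropS => ->; lia.
Qed.

Lemma expmonE n (a : {ffun 'I_n -> 'I_n.+1}) j :
  expmon a j = if insub j is Some i then val (a i) else 0%N.
Proof.
rewrite /expmon.
rewrite (big_morph (fun m => m j) (id1 := 0%N) (op1 := addn)); last 2 first.
- by move=> m1 m2; exact: cmM.
- exact: cm1.
under eq_bigr do rewrite expcmn_ucm.
case: insubP => [i _ <-|jn].
  rewrite (bigD1 i) //= eqxx mul1n big1 ?addn0 // => k.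
  by rewrite -val_eqE => /negPf ->.
by apply: big1 => i _; case: eqP => // ij; move: jn; rewrite -ij ltn_ord.
Qed.

Lemma big_finsupp (T : Type) (idx : T) (op : Monoid.com_law idx) m
    (F : nat -> T) (r : seq nat) :
    uniq r -> {subset finsupp m <= r} -> (forall i, m i = 0%N -> F i = idx) ->
  \big[op/idx]_(i <- finsupp m) F i = \big[op/idx]_(i <- r) F i.
Proof.
move=> ur mr F0; rewrite [RHS](bigID (fun i => i \in finsupp m)) /=.
rewrite [X in op _ X]big1 ?Monoid.mulm1; last first.
  by move=> i; rewrite -cmE_eq0 => /eqP /F0.
rewrite -[RHS]big_filter; apply: perm_big; apply: uniq_perm; rewrite ?fset_uniq ?filter_uniq //.
by move=> i; rewrite mem_filter; case: (boolP (i \in finsupp m)) => // /mr ->.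
Qed.

Definition wt m : nat := \sum_(i <- finsupp m) i.+1 * m i.

Lemma wtM m1 m2 : wt (mmul m1 m2) = (wt m1 + wt m2)%N.
Proof.
rewrite /wt mdomD.
rewrite (@big_finsupp _ _ _ m1 _ (finsupp m1 `|` finsupp m2)%fset) ?fset_uniq //;
  first last.
- by move=> i ->; rewrite muln0.
- by move=> i; rewrite in_fsetU => ->.
rewrite (@big_finsupp _ _ _ m2 _ (finsupp m1 `|` finsupp m2)%fset) ?fset_uniq //;
  first last.
- by move=> i ->; rewrite muln0.
- by move=> i; rewrite in_fsetU orbC => ->.
by rewrite -big_split; apply: eq_bigr => i _; rewrite cmM mulnDr.
Qed.

Lemma wtU i : wt (ucm i) = i.+1.
Proof. by rewrite /wt mdomU big_seq_fset1 cmUU muln1. Qed.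

Lemma leq_wt m i : (i.+1 * m i <= wt m)%N.
Proof.
case: (mdomP m i) => [im|_]; last by rewrite muln0.
by rewrite /wt (big_rem i) //= leq_addr.
Qed.

Lemma wt_supp m i : m i != 0%N -> (i < wt m)%N.
Proof. by move=> mi; have := leq_wt m i; nia. Qed.

Lemma big_wt (T : Type) (idx : T) (op : Monoid.com_law idx) m (F : nat -> T) n :
    wt m = n -> (forall i, m i = 0%N -> F i = idx) ->
  \big[op/idx]_(i <- finsupp m) F i = \big[op/idx]_(i < n) F i.
Proof.
move=> mn F0; rewrite -(big_mkord xpredT F); apply: big_finsupp => //.
  exact: iota_uniq.
by move=> i; rewrite -cmE_neq0 mem_index_iota -mn => /wt_supp.
Qed.

Definition mons n : seq {cmonom nat} :=
  [seq expmon a | a : {ffun 'I_n -> 'I_n.+1} <- enum {ffun 'I_n -> 'I_n.+1}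
                & (\sum_(i < n) i.+1 * a i == n)%N].

Lemma expmon_val n (a : {ffun 'I_n -> 'I_n.+1}) (i : 'I_n) : expmon a i = a i.
Proof. by rewrite expmonE valK. Qed.

(** By [leq_wt] and [wt_supp], a monomial of weight n has exponents at most n and indices below n,
    so the bounded exponent vectors in [dil] miss none. *)
Lemma mem_mons n m : (m \in mons n) = (wt m == n).
Proof.
apply/idP/eqP => [/mapP[a]|mn].
  rewrite mem_filter => /andP[/eqP an _] ->; rewrite -[RHS]an.
  rewrite /wt (@big_finsupp _ _ _ _ _ (index_iota 0 n)) ?iota_uniq //; first last.
  - by move=> i ->; rewrite muln0.
  - move=> i; rewrite -cmE_neq0 mem_index_iota expmonE.
    by case: insubP => // -[].
  by rewrite big_mkord; apply: eq_bigr => i _; rewrite expmon_val.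
have mle i : (m i < n.+1)%N by have := leq_wt m i; rewrite mn; nia.
pose a := [ffun i : 'I_n => Ordinal (mle i)].
have am : expmon a = m.
  apply/eqP/cmP => j; rewrite expmonE.
  case: insubP => [i _ <-|]; first by rewrite ffunE.
  rewrite -leqNgt -mn; case: (m j =P 0%N) => // /eqP /wt_supp.
  by rewrite ltnNge => /negbTE ->.
apply/mapP; exists a; rewrite // mem_filter mem_enum andbT -[X in _ == X]mn.
rewrite /wt (@big_wt _ _ _ _ _ _ mn) => [|i ->]; last by rewrite muln0.
by apply/eqP/eq_bigr => i _; rewrite ffunE.
Qed.

Lemma mons_uniq n : uniq (mons n).
Proof.
rewrite map_inj_in_uniq ?filter_uniq -?enumT ?enum_uniq // => a b _ _ ab.
by apply/ffunP => i; apply/val_inj; rewrite /= -!expmon_val ab.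
Qed.

End Monomials.

(** * Dilation, differentiation and change of point *)

Section Dilation.
Variable A : comNzRingType.
Implicit Types (f : tseries A) (s : nat -> A) (m : {cmonom nat}).

Definition mev s m : A := \prod_(i <- finsupp m) s i ^+ m i.

Lemma mev_wt s m n : wt m = n -> mev s m = \prod_(i < n) s i ^+ m i.
Proof. by move=> mn; apply: big_wt => // i ->; rewrite expr0. Qed.

(** Monomials replace exponent vectors, whose type depends on n, so that different weights can be
    compared. *)
Lemma dilE f s n : dil f s n = \sum_(m <- mons n) f m * mev s m.
Proof.
rewrite /mons big_map big_filter big_enum_cond /dil; apply: eq_bigr => a an.
rewrite (@mev_wt _ _ n); first by under [in RHS]eq_bigr do rewrite expmon_val.
apply/eqP; rewrite -mem_mons; apply/mapP; exists a => //.
by rewrite mem_filter mem_enum andbT.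
Qed.

Lemma perm_mons n i : (i < n)%N ->
  perm_eq [seq m : {cmonom nat} <- mons n | m i != 0%N]
          [seq mmul m (ucm i) | m <- mons (n - i.+1)].
Proof.
move=> i_n; have mulI m m' : mmul m (ucm i) = mmul m' (ucm i) -> m = m'.
  move=> e; apply/eqP/cmP => j; have := congr1 (fun x : {cmonom nat} => x j) e.
  by rewrite !cmM => /addIn.
apply: uniq_perm; first by rewrite filter_uniq ?mons_uniq.
  by rewrite map_inj_uniq ?mons_uniq.
move=> m; rewrite mem_filter mem_mons; apply/andP/mapP => [[mi mn]|[m' + ->]].
  have em : m = mmul (divcm m (ucm i)) (ucm i).
    apply/eqP/cmP => j; rewrite cmM divcmE ucmE; case: eqP => [<-|]; last by lia.
    by rewrite subnK // lt0n.
  exists (divcm m (ucm i)) => //; rewrite mem_mons; apply/eqP.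
  by rewrite -(eqP mn) {2}em wtM wtU addnK.
rewrite mem_mons wtM wtU cmM cmUU addn1 => /eqP ->; split => //.
by rewrite subnK.
Qed.

(** Reindexing by the monomial before differentiation. If [m i = 0] then [divcm m (ucm i)] is no
    true quotient, but the factor [m i] kills the term. *)
Lemma dil_tderiv f s n i : (i < n)%N ->
  dil (tderiv i f) s (n - i.+1)%N
  = \sum_(m <- mons n) f m *+ m i * mev s (divcm m (ucm i)).
Proof.
move=> i_n; rewrite [RHS](bigID (fun m : {cmonom nat} => m i == 0%N)) /=.
rewrite [X in X + _]big1 ?add0r; last by move=> m /eqP ->; rewrite mulr0n mul0r.
rewrite -big_filter (perm_big _ (perm_mons i_n)) big_map dilE.
apply: eq_bigr => m _; rewrite /tderiv cmM cmUU addn1; congr (_ * mev s _).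
by apply/eqP/cmP => j; rewrite divcmE cmM addnK.
Qed.

Lemma dil_eq f s s' : (forall i m, s i != s' i -> m i != 0%N -> f m = 0) ->
  dil f s = dil f s'.
Proof.
move=> fs; apply/funext => n; rewrite !dilE; apply: eq_bigr => m _.
case: (boolP (all (fun i => s i == s' i) (finsupp m))) => [/allP e|].
  by congr (_ * _); apply: eq_big_seq => i /e /eqP ->.
rewrite -has_predC => /hasP[i im si].
by rewrite (fs i m si) ?mul0r // cmE_neq0.
Qed.

End Dilation.

Lemma rmorph_dil (A B : comNzRingType) (phi : {rmorphism A -> B})
    (f : tseries A) (s : nat -> A) n :
  phi (dil f s n) = dil (phi \o f) (phi \o s) n.
Proof.
rewrite rmorph_sum; apply: eq_bigr => a _; rewrite rmorphM rmorph_prod.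
by congr (_ * _); apply: eq_bigr => i _; rewrite rmorphXn.
Qed.

Lemma deriv_prod (A : comNzRingType) (I : eqType) (r : seq I) (F : I -> {poly A}) :
    uniq r ->
  (\prod_(i <- r) F i)^`()
  = \sum_(i <- r) (F i)^`() * \prod_(j <- r | j != i) F j.
Proof.
elim: r => [|i r IH] /=; first by rewrite !big_nil derivC.
case/andP=> ir ur; rewrite !big_cons derivM IH // eqxx /=; congr (_ + _).
  rewrite big_seq_cond [in RHS]big_seq_cond; congr (_ * _); apply: eq_bigl => j.
  by case: (boolP (j \in r)) => // jr; rewrite andbT; case: eqP jr ir => // ->->.
rewrite mulr_sumr; apply: eq_big_seq => j jr; rewrite big_cons.
by rewrite ifT 1?mulrCA //; apply: contraNneq ir => ->.
Qed.

Lemma deriv_mev (A : comNzRingType) (s : nat -> {poly A}) m n : wt m = n ->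
  (mev s m)^`() = \sum_(i < n) (s i)^`() * mev s (divcm m (ucm (val i))) *+ m i.
Proof.
move=> mn; rewrite (mev_wt _ mn) deriv_prod ?index_enum_uniq //.
apply: eq_bigr => i _; rewrite deriv_exp.
case: (posnP (m i)) => [->|mi]; first by rewrite !mulr0n mul0r.
rewrite -mulrnAl -mulrA mulrnAl; congr (_ * _ *+ _).
rewrite /mev (@big_finsupp _ _ _ _ _ (index_iota 0 n)) ?iota_uniq //; first last.
- by move=> j ->.
- move=> j; rewrite -cmE_neq0 divcmE mem_index_iota => mj; have := @wt_supp m j.
  by rewrite mn; apply; apply: contraNneq mj => ->.
rewrite big_mkord [RHS](bigD1 i) //= divcmE ucmE eqxx subn1; congr (_ * _).
apply: eq_bigr => j ji; rewrite divcmE ucmE.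
by rewrite val_eqE eq_sym (negPf ji) subn0.
Qed.

(** Chain rule: in weight n only $t_1,\dots,t_n$ occur, and differentiating in $t_{i+1}$ lowers the
    weight by i + 1. *)
Lemma deriv_dil (A : comNzRingType) (f : tseries A) (s : nat -> {poly A}) n :
  (dil (polyC \o f) s n)^`()
  = \sum_(i < n) (s i)^`() * dil (polyC \o tderiv i f) s (n - i.+1)%N.
Proof.
rewrite dilE raddf_sum /=.
transitivity (\sum_(m <- mons n) \sum_(i < n)
    (s i)^`() * ((f m)%:P *+ m i * mev s (divcm m (ucm (val i))))).
  apply: eq_big_seq => m; rewrite mem_mons => /eqP mn.
  rewrite derivM derivC mul0r add0r (deriv_mev _ mn) mulr_sumr.
  by apply: eq_bigr => i _; rewrite mulrnAr mulrnAl mulrnAr mulrCA.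
rewrite exchange_big; apply: eq_bigr => i _; rewrite -mulr_sumr.
have -> : polyC \o tderiv i f = tderiv (val i) (polyC \o f).
  by apply/funext => m; rewrite /tderiv /= polyCMn.
by rewrite dil_tderiv // ltn_ord.
Qed.

(** * Formal identities *)

Lemma fps_lamXM (A : comNzRingType) (z : A) (f : fps A) j n :
  (lam z ^+ j * f) n = if (j <= n)%N then z ^+ j * f (n - j)%N else 0.
Proof.
elim: j n => [|j IH] n; first by rewrite !expr0 !mul1r subn0.
rewrite exprS -mulrA fps_lamM; case: n => [|n] //.
by rewrite IH ltnS subSS exprS; case: ifP; rewrite ?mulrA ?mulr0.
Qed.

(** Serves to discard the even times: index [k.*2] stands for $t_{2k+1}$, and [k.*2.+1] for
    $t_{2k+2}$. *)
Lemma sum_even (V : nmodType) (F : nat -> V) M : (forall k, F k.*2.+1 = 0) ->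
  \sum_(i < M.*2) F i = \sum_(k < M) F k.*2.
Proof.
move=> F0; elim: M => [|M IH]; first by rewrite !big_ord0.
by rewrite doubleS !big_ord_recr /= IH F0 addr0.
Qed.

Section MiwaPoly.
Variable K : numFieldType.

Lemma miwaXE i : miwa ('X : {poly K}) i = (i.+1%:R^-1)%:P * 'X^(i.+1).
Proof. by rewrite /miwa -polyC_natr polyCV mulrC. Qed.

Lemma horner_miwaX (c : K) i : (miwa 'X i).[c] = miwa c i.
Proof. by rewrite miwaXE mul_polyC hornerZ hornerXn mulrC. Qed.

Lemma deriv_miwaX i : (miwa ('X : {poly K}) i)^`() = 'X^i.
Proof.
rewrite miwaXE mul_polyC derivZ derivXn /=.
by rewrite -(scaler_nat i.+1 'X^i) scalerA mulVf ?pnatr_eq0 // scale1r.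
Qed.

Lemma horner_dil (f : tseries K) (s : nat -> {poly K}) (c : K) n :
  (dil (polyC \o f) s n).[c] = dil f (fun i => (s i).[c]) n.
Proof.
rewrite -[LHS]/(horner_eval c _) rmorph_dil; congr (dil _ _ n).
by apply/funext => m /=; rewrite /horner_eval hornerC.
Qed.

End MiwaPoly.

(** * Bilinear and trilinear relations for KdV tau functions *)

Section KdV.
Variables (K : numFieldType) (tau : tseries K).
Hypothesis Htau : KdV_tau tau.
Implicit Types (t s : nat -> K) (a b : K).

Let T := dil tau.

(* f does not depend on t_2, t_4, ... *)
Definition odd_times (f : tseries K) : Prop :=
  forall k (m : {cmonom nat}), m k.*2.+1 != 0%N -> f m = 0.

Lemma odd_times_dil f s s' : odd_times f -> (forall k, s k.*2 = s' k.*2) ->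
  dil f s = dil f s'.
Proof.
move=> fodd ss; apply: dil_eq => i m; case: (boolP (odd i)) => [oi _ mi|/even_halfK ei].
  by apply: (fodd i./2); rewrite odd_halfK // prednK ?odd_gt0.
by rewrite -ei ss eqxx.
Qed.

(** At m divided by $t_{2k+2}$, the vanishing derivative is [tau m] times the exponent of $t_{2k+2}$
    in m, which is nonzero in K. *)
Lemma KdV_odd_times : odd_times tau.
Proof.
move=> k m mk; have := Htau.2 k (divcm m (ucm k.*2.+1)).
move/eqP; rewrite /tderiv mulrn_eq0 /= => /eqP <-; congr tau.
apply/eqP/cmP => j; rewrite cmM divcmE ucmE.
by case: (k.*2.+1 =P j) => [<-|_]; rewrite ?subnK ?lt0n // subn0 addn0.
Qed.

Lemma tderiv_odd_times i : odd_times (tderiv i tau).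
Proof.
move=> k m mk; rewrite /tderiv (KdV_odd_times (k := k)) ?mul0rn //.
by rewrite cmM addn_eq0 negb_and mk.
Qed.

Lemma miwaN a k : miwa (- a) k.*2 = - miwa a k.*2.
Proof. by rewrite /miwa exprNn -signr_odd /= odd_double expr1 mulN1r mulNr. Qed.

(** [-a] and -[a] agree in the odd times. *)
Lemma dil_miwaN t a : T (t + miwa (- a)) = T (t - miwa a).
Proof.
by apply: (odd_times_dil KdV_odd_times) => k; rewrite !fctE miwaN.
Qed.

(** The dilated operator $\sum_k a^{2k+1}\partial_{t_{2k+1}}$. On a KdV tau function it is
    $a\,\partial_a$ acting through the shift by [a]. *)
Definition pderivs f a s : fps K :=
  fps_sum (fun k => lam a ^+ k.*2.+1 * dil (tderiv k.*2 f) s).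

Lemma pderivsN a s : pderivs tau (- a) s = - pderivs tau a s.
Proof.
apply/funext => n; rewrite fpsN /pderivs /fps_sum -sumrN; apply: eq_bigr => k _.
rewrite lamN exprNn -signr_odd /= odd_double expr1 mulN1r mulNr.
by rewrite fpsN.
Qed.

Lemma deriv_dil_miwa (s : nat -> {poly K}) (e a : K) n :
    (forall i, (s i)^`() = e%:P * 'X^i) ->
  a * ((dil (polyC \o tau) s n)^`()).[a]
  = e * pderivs tau a (fun i => (s i).[a]) n.
Proof.
move=> s'; rewrite deriv_dil horner_sum /pderivs /fps_sum.
pose F i := if (i < n)%N then
  a ^+ i.+1 * dil (tderiv i tau) (fun i => (s i).[a]) (n - i.+1)%N else 0.
(* The range is padded with zeros to n + 1 pairs of indices; [sum_even] then leaves n + 1 terms, the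
   range of [fps_sum] in degree n. *)
transitivity (e * \sum_(i < n.+1.*2) F i).
  have n2 : (n <= n.+1.*2)%N by lia.
  rewrite !mulr_sumr (big_ord_widen _ (fun i => a * ((s i)^`() *
    dil (polyC \o tderiv i tau) s (n - i.+1)%N).[a]) n2) big_mkcond /=.
  apply: eq_bigr => i _; rewrite /F; case: ifP => _; last by rewrite mulr0.
  rewrite hornerM s' hornerCM hornerXn horner_dil exprS; ring.
rewrite sum_even => [|k].
  by congr (_ * _); apply: eq_bigr => k _; rewrite /F fps_lamXM.
rewrite /F; case: ifP => // _; rewrite (_ : dil _ _ _ = 0) ?mulr0 //.
apply: big1 => x _; rewrite [X in X * _](_ : _ = 0) ?mul0r //; exact: Htau.2.
Qed.

(** * The Hirota product as a polynomial in w *)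

Section Hirota.
Variables (t t' : nat -> K) (N : nat).
Let ptau : tseries {poly K} := polyC \o tau.
Let F := dil ptau ((polyC \o t) - miwa 'X).
Let G := dil ptau ((polyC \o t') + miwa 'X).

Let hornerF c n : (F n).[c] = T (t - miwa c) n.
Proof.
rewrite horner_dil; congr (dil tau _ n); apply/funext => i.
by rewrite !fctE hornerD hornerN hornerC horner_miwaX.
Qed.

Let hornerG c n : (G n).[c] = T (t' + miwa c) n.
Proof.
rewrite horner_dil; congr (dil tau _ n); apply/funext => i.
by rewrite !fctE hornerD hornerC horner_miwaX.
Qed.

Lemma horner_hirota c : ((F * G) N).[c] = (T (t - miwa c) * T (t' + miwa c)) N.
Proof.
rewrite !fpsM horner_sum; apply: eq_bigr => i _.
by rewrite hornerM hornerF hornerG.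
Qed.

(** The product rule; the minus sign comes from the shift by -[w] in [F], where [deriv_dil_miwa] is
    used with e = -1. *)
Lemma deriv_hirota a : a * ((F * G) N)^`().[a]
  = (T (t - miwa a) * pderivs tau a (t' + miwa a)
     - pderivs tau a (t - miwa a) * T (t' + miwa a)) N.
Proof.
rewrite fpsB !fpsM raddf_sum horner_sum mulr_sumr -sumrB; apply: eq_bigr => i _ /=.
have dF n : a * (F n)^`().[a] = - pderivs tau a (t - miwa a) n.
  rewrite (@deriv_dil_miwa _ (- 1)) ?mulN1r => [|j].
    congr (- pderivs _ _ _ _); apply/funext => j.
    by rewrite !fctE hornerD hornerN hornerC horner_miwaX.
  by rewrite !fctE derivD derivN derivC deriv_miwaX add0r polyCN mulN1r.
have dG n : a * (G n)^`().[a] = pderivs tau a (t' + miwa a) n.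
  rewrite (@deriv_dil_miwa _ 1) ?mul1r => [|j].
    congr (pderivs _ _ _ _); apply/funext => j.
    by rewrite !fctE hornerD hornerC horner_miwaX.
  by rewrite !fctE derivD derivC deriv_miwaX add0r mul1r.
rewrite derivM hornerD !hornerM mulrDr mulrA dF mulrCA dG hornerF hornerG; ring.
Qed.

End Hirota.

Lemma KdV_bilinear t a b :
  (lam a + lam b) * (T (t - miwa a + miwa b) * T (t + miwa a))
  - (lam b + lam b) * (T t * T (t + miwa b))
  + (lam b - lam a) * (T (t + miwa a + miwa b) * T (t - miwa a)) = 0.
Proof.
(* Inside tau, [-a] cancels [a]; but the exponential depends on all times, and there [-a] creates
   the pole at w = -a. *)
pose t1 := t + miwa a + miwa b + miwa (- a).
have t1t : t1 - t = miwa a + miwa b + miwa (- a).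
  by apply/funext => i; rewrite /t1 !fctE; ring.
have Ea : T (t1 - miwa a) = T (t - miwa a + miwa b).
  apply: (odd_times_dil KdV_odd_times) => k; rewrite /t1 !fctE miwaN; ring.
have Eb : T (t1 - miwa b) = T t.
  apply: (odd_times_dil KdV_odd_times) => k; rewrite /t1 !fctE miwaN; ring.
have Ec : T (t1 - miwa (- a)) = T (t + miwa a + miwa b).
  apply: (odd_times_dil KdV_odd_times) => k; rewrite /t1 !fctE; ring.
rewrite -Ea -Ec -{1}Eb -(dil_miwaN t a).
have E N : 0 = (a + b) * (T (t1 - miwa a) * T (t + miwa a)) N
    - 2%:R * b * (T (t1 - miwa b) * T (t + miwa b)) N
    + (b - a) * (T (t1 - miwa (- a)) * T (t + miwa (- a))) N.
  have := Htau.1.2 t1 t N; cbv zeta; rewrite t1t => H.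
  by rewrite -!horner_hirota -exp_coef_residue3 H mulr0.
(* Multiplication by [lam] raises the degree by one: degree 0 is trivial, and degree N + 1 is
   [E N]. *)
rewrite !(mulrDl, mulNr); apply/funext => -[|N]; rewrite !(fpsD, fpsN) !fps_lamM.
  by rewrite !(addr0, oppr0).
rewrite [RHS](E N); ring.
Qed.

(* The limit b -> a of KdV_bilinear, divided by b - a. *)
Lemma KdV_bilinear_diag t a :
  T (t + miwa a *+ 2) * T (t - miwa a)
  = T t * T (t + miwa a)
    + 2%:R * (T t * pderivs tau a (t + miwa a) - pderivs tau a t * T (t + miwa a)).
Proof.
pose t1 := t + miwa a + miwa a + miwa (- a).
have t1t : t1 - t = miwa a + miwa a + miwa (- a).
  by apply/funext => i; rewrite /t1 !fctE; ring.
have even_t1 k : (t1 - miwa a) k.*2 = t k.*2.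
  rewrite /t1 !fctE miwaN; ring.
have Ea : T (t1 - miwa a) = T t by exact: odd_times_dil KdV_odd_times even_t1.
have Ea' : pderivs tau a (t1 - miwa a) = pderivs tau a t.
  congr fps_sum; apply/funext => k; congr (_ * _).
  exact: odd_times_dil (tderiv_odd_times _) even_t1.
have Ec : T (t1 - miwa (- a)) = T (t + miwa a *+ 2).
  apply: (odd_times_dil KdV_odd_times) => k; rewrite /t1 mulr2n !fctE; ring.
rewrite -Ea -Ec -Ea' -(dil_miwaN t a); apply/funext => N.
have := Htau.1.2 t1 t N; cbv zeta; rewrite t1t => H.
set P := (_ * _ : fps {poly K}) N in H.
(* The relation reads P(-a) = P(a) + 2 a P'(a), and [deriv_hirota] computes a P'(a). *)
have := exp_coef_residue2 a P; rewrite H mulr0 -!mulrA /P deriv_hirota !horner_hirota.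
move=> /esym/eqP; rewrite subr_eq0 subr_eq => /eqP ->.
by rewrite addrC fpsD mulr2n mulrDl !mul1r fpsD mulr_natl mulr2n.
Qed.

Lemma KdV_trilinear t a b :
  (lam b - lam a) *
    (T (t + miwa a + miwa b) * T (t - miwa a) * T (t - miwa b)
     - T (t - miwa a - miwa b) * T (t + miwa a) * T (t + miwa b))
  = (lam b + lam a) *
    (T (t + miwa a - miwa b) * T (t - miwa a) * T (t + miwa b)
     - T (t - miwa a + miwa b) * T (t + miwa a) * T (t - miwa b)).
Proof.
have E1 := KdV_bilinear t a b.
have := KdV_bilinear t (- a) (- b); rewrite !lamN !dil_miwaN.
have -> : T (t - miwa (- a)) = T (t + miwa a).
  apply: (odd_times_dil KdV_odd_times) => k; rewrite !fctE miwaN; ring.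
have -> : T (t - miwa (- a) - miwa b) = T (t + miwa a - miwa b).
  apply: (odd_times_dil KdV_odd_times) => k; rewrite !fctE miwaN; ring.
have -> : T (t + miwa (- a) - miwa b) = T (t - miwa a - miwa b).
  apply: (odd_times_dil KdV_odd_times) => k; rewrite !fctE miwaN; ring.
move=> E2; apply/eqP; rewrite -subr_eq0; apply/eqP.
(* The difference of the two sides is E1 times [T (t - miwa b)] plus E2 times [T (t + miwa b)]. *)
rewrite -[RHS](mulr0 (T (t - miwa b))) -{}E1 -[RHS]addr0.
rewrite -[X in _ = _ + X](mulr0 (T (t + miwa b))) -{}E2; ring.
Qed.

(** [KdV_bilinear_diag] for a times [T (t - miwa a)], minus that for -a times [T (t + miwa a)]: the
    terms without derivatives cancel. *)
Lemma KdV_trilinear_diag t a :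
  T (t + miwa a *+ 2) * T (t - miwa a) ^+ 2
    - T (t - miwa a *+ 2) * T (t + miwa a) ^+ 2
  = 2%:R * (T (t - miwa a) * (T t * pderivs tau a (t + miwa a)
                              - pderivs tau a t * T (t + miwa a))
            + T (t + miwa a) * (T t * pderivs tau a (t - miwa a)
                                - pderivs tau a t * T (t - miwa a))).
Proof.
have E1 := KdV_bilinear_diag t a.
have := KdV_bilinear_diag t (- a); rewrite !pderivsN !dil_miwaN.
have -> : T (t - miwa (- a)) = T (t + miwa a).
  apply: (odd_times_dil KdV_odd_times) => k; rewrite !fctE miwaN; ring.
have -> : T (t + miwa (- a) *+ 2) = T (t - miwa a *+ 2).
  apply: (odd_times_dil KdV_odd_times) => k; rewrite !mulr2n !fctE miwaN; ring.
have -> : pderivs tau a (t + miwa (- a)) = pderivs tau a (t - miwa a).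
  congr fps_sum; apply/funext => k; congr (_ * _).
  by apply: (odd_times_dil (tderiv_odd_times _)) => j; rewrite !fctE miwaN.
move=> E2; rewrite !expr2 !mulrA E1 E2; ring.
Qed.

(** The summand is linear in the derivatives at s, s' and t, with factors free of k that [fps_sumMl]
    pulls out. *)
Lemma pderivs_W t s s' a :
  fps_sum (fun k => lam a ^+ k.*2.+1 *
      (T s' * W (@dil _) k.*2 tau t s + T s * W (@dil _) k.*2 tau t s'))
  = T s' * (T t * pderivs tau a s - pderivs tau a t * T s)
    + T s * (T t * pderivs tau a s' - pderivs tau a t * T s').
Proof.
pose g s k := lam a ^+ k.*2.+1 * dil (tderiv k.*2 tau) s.
transitivity (fps_sum (fun k => (T t * T s') * g s k + (T t * T s) * g s' k
    + (- (2%:R * T s * T s')) * g t k)).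
  by congr fps_sum; apply/funext => k; rewrite /W /g -/T; ring.
have g0 x k n : (n < k)%N -> g x k n = 0.
  by move=> nk; rewrite /g fps_lamXM ifF //; apply/negbTE; lia.
rewrite !fps_sumD !fps_sumMl; try exact: g0.
rewrite -![fps_sum (g _)]/(pderivs tau a _); ring.
Qed.

End KdV.

(** * Absolutely convergent series *)

Section Tannery.
Variable R : realType.

(** The range of summation grows with N: a fixed head converges term by term, and the rest is
    dominated by a tail of M. *)
Lemma real_tannery (a : nat -> nat -> R) (b M : nat -> R) :
    (forall N k, `|a N k| <= M k) -> cvgn (series M) ->
    (forall k, (a^~ k) @ \oo --> b k) ->
  cvgn (series b) /\
  (fun N => \sum_(k < N) a N k) @ \oo --> limn (series b).
Proof.
move=> aM cM ab.
have bM k : `|b k| <= M k.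
  apply: (cvgr_to_le (cvg_norm (ab k))).
  by near=> N.
have M0 k : 0 <= M k by exact: le_trans (bM k).
have cb : cvgn (series b) by apply: normed_cvg; apply: series_le_cvg cM => // n; exact: normr_ge0.
split=> //; apply: cvg_sub0 cb.
apply/cvgr0Pnorm_lt => e e0.
(* The tail of a - b is at most twice a tail of M, which leaves e / 2 for the head. *)
have e4 : 0 < e / 4%:R by rewrite divr_gt0.
have ndM : nondecreasing_seq (series M) by exact: nondecreasing_series.
have [K _ MK] : \forall K \near \oo, `|limn (series M) - series M K| < e / 4%:R.
  by move/cvgrPdist_lt: cM; apply.
have {}MK N : (K <= N)%N -> \sum_(K <= k < N) M k < e / 4%:R.
  move=> KN; rewrite -sub_series_geq //.
  have := MK K (leqnn K); have := nondecreasing_cvgn_le ndM cM N.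
  by move=> h /(le_lt_trans (ler_norm _)); lra.
have head : (fun N => \sum_(k < K) (a N k - b k)) @ \oo --> (0 : R).
  rewrite -[X in _ --> X](_ : \sum_(k < K) (b k - b k) = 0); last first.
    by rewrite big1 // => k _; rewrite subrr.
  apply: cvg_big => [|k _]; first exact: add_continuous.
  by apply: cvgB => //; exact: cvg_cst.
near=> N.
have KN : (K <= N)%N by near: N; exists K.
have hN : `|\sum_(k < K) (a N k - b k)| < e / 2%:R.
  near: N; move/cvgr0Pnorm_lt: head; apply; lra.
rewrite [X in `|X|](_ : _ = \sum_(0 <= k < N) (a N k - b k)); last first.
  by rewrite !fctE /series /= sumrB !big_mkord.
rewrite (big_cat_nat _ KN) //= big_mkord.
apply: le_lt_trans (ler_normD _ _) _.
have : `|\sum_(K <= k < N) (a N k - b k)| <= \sum_(K <= k < N) (M k + M k).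
  apply: le_trans (ler_norm_sum _ _ _) _; apply: ler_sum => k _.
  by apply: le_trans (ler_normB _ _) _; apply: lerD.
rewrite [X in _ <= X]big_split /=; have := MK N KN; lra.
Unshelve. all: by end_near.
Qed.

End Tannery.

(** * Complex series and their values at $\lambda = 1$ *)

Section ComplexSeries.
Variable R : realType.
Local Notation C := (R[i] : numFieldType).
Local Notation Re := (@complex.Re R).
Local Notation Im := (@complex.Im R).
Implicit Types (u v : nat -> C) (l : C).

Lemma cvg_Re u l : u @ \oo --> l -> (fun n => Re (u n)) @ \oo --> Re l.
Proof.
move=> ul; apply/cvgrPdist_lt => e e0.
have e0' : (0 : C) < e%:C%C by rewrite ltcR.
move/cvgrPdist_lt: ul => /(_ _ e0'); apply: filterS => n.
rewrite -ltcR; apply: le_lt_trans; apply: le_trans (normc_ge_Re _).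
by rewrite raddfB.
Qed.

Lemma cvg_Im u l : u @ \oo --> l -> (fun n => Im (u n)) @ \oo --> Im l.
Proof.
pose c : C := - 'i%C.
move=> ul; have : (fun n => c * u n) @ \oo --> c * l.
  exact: (cvgM (cvg_cst c) ul).
move=> /cvg_Re.
have E (z : C) : Re (c * z) = Im z.
  by rewrite /c mulNr raddfN /= mulrC ReiNIm opprK.
by rewrite E; under eq_fun do rewrite E.
Qed.

Lemma cvg_real_complex (x : nat -> R) (y : R) :
  x @ \oo --> y -> (fun n => (x n)%:C%C : C) @ \oo --> (y%:C%C : C).
Proof.
move=> xy; apply/cvgrPdist_lt => e e0.
have eE : e = (Re e)%:C%C by rewrite RRe_real // gtr0_real.
have e0' : 0 < Re e by rewrite -ltcR -eE.
move/cvgrPdist_lt: xy => /(_ _ e0'); apply: filterS => n.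
rewrite -ltcR -eE -rmorphB /= normc_def /= expr0n addr0 sqrtr_sqr.
by [].
Qed.

Lemma cvg_complex u l : (fun n => Re (u n)) @ \oo --> Re l ->
  (fun n => Im (u n)) @ \oo --> Im l -> u @ \oo --> l.
Proof.
move=> /cvg_real_complex ur /cvg_real_complex ui.
rewrite (complexE l) (_ : u = fun n => (Re (u n))%:C%C + 'i%C * (Im (u n))%:C%C).
  exact: (cvgD ur (cvgM (cvg_cst ('i%C : C)) ui)).
by apply/funext => n; rewrite -complexE.
Qed.

Lemma normc_ge_Im (z : C) : `|Im z|%:C%C <= `|z|.
Proof.
have -> : `|z| = `|- 'i%C * z| by rewrite normrM normrN complexiE normCi mul1r.
have -> : Im z = Re (- 'i%C * z) by rewrite mulNr raddfN /= mulrC ReiNIm opprK.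
exact: normc_ge_Re.
Qed.

Lemma lec_Re (z w : C) : z <= w -> Re z <= Re w.
Proof. by rewrite lecE => /andP[]. Qed.

Lemma Re_series u : (fun n => Re (series u n)) = series (fun n => Re (u n)).
Proof. by apply/funext => n; rewrite /series /= raddf_sum. Qed.

Lemma Im_series u : (fun n => Im (series u n)) = series (fun n => Im (u n)).
Proof. by apply/funext => n; rewrite /series /= raddf_sum. Qed.

(** As M dominates norms in the order of [R[i]], it is real and non-negative, so its bounded partial
    sums converge. The real version applies to real and imaginary parts, both bounded by the
    norm. *)
Lemma tannery (a : nat -> nat -> C) (b M : nat -> C) (B : C) :
    (forall N k, `|a N k| <= M k) -> (forall N, \sum_(k < N) M k <= B) ->
    (forall k, (a^~ k) @ \oo --> b k) ->
  cvgn (series b) /\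
  (fun N => \sum_(k < N) a N k) @ \oo --> limn (series b).
Proof.
move=> aM MB ab.
have M0 k : 0 <= M k by exact: le_trans (aM 0%N k).
have cM : cvgn (series (fun k => Re (M k))).
  apply: nondecreasing_is_cvgn.
    by apply: nondecreasing_series => k _ _; exact: lec_Re (M0 k).
  exists (Re B) => _ [N _ <-]; rewrite /series /= big_mkord -raddf_sum.
  exact: lec_Re (MB N).
have [cr ar] := @real_tannery R (fun N k => Re (a N k)) (fun k => Re (b k)) _
  (fun N k => lec_Re (le_trans (normc_ge_Re _) (aM N k))) cM
  (fun k => cvg_Re (ab k)).
have [ci ai] := @real_tannery R (fun N k => Im (a N k)) (fun k => Im (b k)) _
  (fun N k => lec_Re (le_trans (normc_ge_Im _) (aM N k))) cM
  (fun k => cvg_Im (ab k)).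
pose l : C := (limn (series (fun k => Re (b k))) +i* limn (series (fun k => Im (b k))))%C.
have bl : series b @ \oo --> l.
  by apply: cvg_complex; rewrite ?Re_series ?Im_series.
have -> : limn (series b) = l by exact: norm_cvg_lim bl.
split; first exact: bl.
apply: cvg_complex.
  by under eq_fun do rewrite raddf_sum.
by under eq_fun do rewrite raddf_sum.
Qed.

(** The order of [R[i]] compares only numbers with equal imaginary parts, so the limit must be shown
    to be real as well. *)
Lemma sum_le_limn u N : (forall k, 0 <= u k) -> cvgn (series u) ->
  \sum_(k < N) u k <= limn (series u).
Proof.
move=> u0 cu; have Im0 k : Im (u k) = 0 by exact: ger0_Im.
have /cvg_Re := cu; have /cvg_Im := cu; rewrite Re_series Im_series.
move=> ui ur; rewrite lecE; apply/andP; split.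
  rewrite raddf_sum big1 //= eq_sym; apply/eqP; apply: (norm_cvg_unique _ ui).
  rewrite (_ : series _ = cst 0); first exact: cvg_cst.
  by apply/funext => n; rewrite /series /= big1.
rewrite -(norm_cvg_lim ur) raddf_sum -(big_mkord xpredT (fun k => Re (u k))).
apply: (nondecreasing_cvgn_le (u_ := series (fun k => Re (u k)))).
  by apply: nondecreasing_series => k _ _; exact: lec_Re (u0 k).
exact: (cvgP _ ur).
Qed.

Definition abs_bounded u (B : C) : Prop := forall N, \sum_(k < N) `|u k| <= B.

Lemma abs_bounded_cvgn u B : abs_bounded u B -> cvgn (series u).
Proof.
move=> uB; have [//] := @tannery (fun=> u) u (fun k => `|u k|) B
  (fun _ _ => lexx _) uB (fun k => cvg_cst (u k : C)).
Qed.

(** Specialisation at $\lambda = 1$ as a relation. It respects the ring operations, and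
    [has_sum_unique] then turns formal identities into numerical ones. *)
Definition has_sum (f : fps R[i]) l : Prop :=
  (exists B, abs_bounded f B) /\ series (f : nat -> C) @ \oo --> l.

Lemma has_sum_unique f l l' : has_sum f l -> has_sum f l' -> l = l'.
Proof. by move=> [_ fl] [_ fl']; exact: norm_cvg_unique fl fl'. Qed.

Lemma has_sumD f g l l' : has_sum f l -> has_sum g l' -> has_sum (f + g) (l + l').
Proof.
move=> [[B fB] fl] [[B' gB] gl]; split.
  exists (B + B') => N; apply: le_trans (lerD (fB N) (gB N)).
  by rewrite -big_split; apply: ler_sum => n _; exact: ler_normD.
have -> : series (f + g : fps R[i]) = series f + series g.
  by apply/funext => n; exact: big_split.
exact: (cvgD fl gl).
Qed.

Lemma has_sumN f l : has_sum f l -> has_sum (- f) (- l).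
Proof.
move=> [[B fB] fl]; split.
  by exists B => N; under eq_bigr do rewrite fpsN normrN; exact: fB.
have -> : series (- f : fps R[i]) = - series f.
  by apply/funext => n; exact: sumrN.
exact: (cvgN fl).
Qed.

Lemma has_sumB f g l l' : has_sum f l -> has_sum g l' -> has_sum (f - g) (l - l').
Proof. by move=> fl /has_sumN; exact: has_sumD. Qed.

Lemma has_sum_lam (z : R[i]) : has_sum (lam z) z.
Proof.
have E N (F : nat -> R[i]) : (forall k, F k.+2 = 0) -> F 0%N = 0 ->
    \sum_(k < N.+2) F k = F 1%N.
  by move=> F2 F0; rewrite 2!big_ord_recl /= F0 add0r big1 ?addr0 // => i _; exact: F2.
split.
  exists `|z| => -[|[|N]]; rewrite ?big_ord0 ?big_ord1 ?normr0 //.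
  by rewrite (E N (fun k => `|lam z k|)) => [|k|]; rewrite /lam /= ?normr0.
rewrite -(cvg_shiftn 2) (_ : [sequence _]_n = cst z); first exact: cvg_cst.
apply/funext => n; rewrite /= /series /= addn2 big_mkord E //.
Qed.

Lemma sum_triangle (V : nmodType) (F : nat -> nat -> V) N :
  \sum_(n < N) \sum_(i < n.+1) F i (n - i)%N
  = \sum_(i < N) \sum_(j < N - i) F i j.
Proof.
elim: N => [|N IH]; first by rewrite !big_ord0.
rewrite big_ord_recr /= {}IH big_ord_recr [RHS]big_ord_recr /= subnn subSnn.
rewrite big_ord1 addrA -big_split; congr (_ + _); apply: eq_bigr => i _.
by rewrite subSn ?(ltnW (ltn_ord i)) // big_ord_recr.
Qed.

(** Grouped by the index of f, the N-th partial sum of the product is $\sum_{i<N} f_i S_{N-i}(g)$,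
    where $S$ denotes partial sums; Tannery applies with majorant $|f_i| B'$. *)
Lemma has_sumM f g l l' : has_sum f l -> has_sum g l' -> has_sum (f * g) (l * l').
Proof.
move=> [[B fB] fl] [[B' gB] gl].
have B'0 : 0 <= B' by apply: le_trans (gB 0%N); rewrite big_ord0.
split.
  exists (B * B') => N; apply: le_trans (ler_wpM2r B'0 (fB N)).
  rewrite mulr_suml.
  apply: (@le_trans _ _ (\sum_(n < N) \sum_(i < n.+1) `|f i| * `|g (n - i)%N|)).
    apply: ler_sum => n _; rewrite fpsM; apply: le_trans (ler_norm_sum _ _ _) _.
    by apply: ler_sum => i _; rewrite normrM.
  rewrite (sum_triangle (fun i j => `|f i| * `|g j|)); apply: ler_sum => i _.
  by rewrite -mulr_sumr ler_wpM2l.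
have -> : series (f * g : fps R[i]) = fun N => \sum_(i < N) f i * series g (N - i)%N.
  apply/funext => N; rewrite /series /= big_mkord.
  rewrite (sum_triangle (fun i j => f i * g j)); apply: eq_bigr => i _.
  by rewrite -mulr_sumr big_mkord.
have gl' i : (fun N => f i * series g (N - i)%N) @ \oo --> (f i * l' : C).
  apply: (cvgM (cvg_cst (f i : C))).
  by have := gl; rewrite -(cvg_centern i).
have fB' N : \sum_(i < N) `|f i| * B' <= B * B'.
  by rewrite -mulr_suml ler_wpM2r.
have [] := @tannery (fun N i => f i * series g (N - i)%N) (fun i => f i * l')
  (fun i => `|f i| * B') (B * B') _ fB' gl'.
  move=> N i; rewrite normrM ler_wpM2l // /series /= big_mkord.
  exact: le_trans (ler_norm_sum _ _ _) (gB _).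
move=> _; congr (_ --> _); apply: norm_cvg_lim.
rewrite (_ : series _ = fun N => series f N * l').
  exact: (cvgM fl (cvg_cst (l' : C))).
by apply/funext => N; rewrite /series /= mulr_suml.
Qed.

(** The bound is explicit because [tderiv_has_sum] sums such bounds over k. *)
Lemma abs_bounded_lamXM (z : R[i]) (f : fps R[i]) B j :
  abs_bounded f B -> abs_bounded (lam z ^+ j * f) (`|z| ^+ j * B).
Proof.
move=> fB; elim: j => [|j IH]; first by rewrite !expr0 !mul1r.
rewrite !exprS -!mulrA => -[|N].
  by rewrite big_ord0 mulr_ge0 //; apply: le_trans (IH 0%N); rewrite big_ord0.
rewrite big_ord_recl fps_lamM normr0 add0r.
under eq_bigr do rewrite lift0 fps_lamM normrM.
by rewrite -mulr_sumr ler_wpM2l.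
Qed.

Lemma has_sumX f l j : has_sum f l -> has_sum (f ^+ j) (l ^+ j).
Proof.
move=> fl; elim: j => [|j IH]; last by rewrite !exprS; exact: has_sumM.
rewrite !expr0; split.
  exists 1 => -[|N]; first by rewrite big_ord0.
  by rewrite big_ord_recl big1 ?addr0 ?normr1 // => i _; rewrite fps1 normr0.
rewrite -(cvg_shiftn 1) (_ : [sequence _]_n = cst 1); first exact: cvg_cst.
apply/funext => n; rewrite /= /series /= addn1 big_mkord big_ord_recl big1.
  by rewrite addr0.
by move=> i _; rewrite fps1.
Qed.

(** Since [g k] starts in degree k, the N-th partial sum of [fps_sum g] is the sum over k < N of the
    N-th partial sums of [g k], and Tannery applies with majorant M. *)
Lemma has_sum_fps_sum (g : nat -> fps R[i]) (b M : nat -> C) (B : C) :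
    (forall k n, (n < k)%N -> g k n = 0) -> (forall k, abs_bounded (g k) (M k)) ->
    (forall N, \sum_(k < N) M k <= B) -> (forall k, has_sum (g k) (b k)) ->
  cvgn (series b) /\ has_sum (fps_sum g) (limn (series b)).
Proof.
move=> g0 gM MB gb.
have swap (V : nmodType) (h : nat -> nat -> V) N :
    (forall k n, (n < k)%N -> h k n = 0) ->
    \sum_(n < N) \sum_(k < n.+1) h k n = \sum_(k < N) \sum_(n < N) h k n.
  move=> h0; rewrite exchange_big; apply: eq_bigr => n _ /=.
  rewrite (big_ord_widen _ (fun k => h k n) (ltn_ord n)) big_mkcond.
  apply: eq_bigr => k _; case: ifP => // /negbT.
  by rewrite -leqNgt => /h0.
have [cb gl] := tannery (a := fun N k => series (g k : nat -> C) N)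
  (fun N k => le_trans (ler_norm_sum _ _ _) (eq_ind_r (fun x => x <= M k) (gM k N)
     (big_mkord xpredT (fun n => `|g k n|)))) MB (fun k => (gb k).2).
split=> //; split.
  exists B => N; apply: le_trans (MB N).
  apply: (@le_trans _ _ (\sum_(n < N) \sum_(k < n.+1) `|g k n|)).
    by apply: ler_sum => n _; exact: ler_norm_sum.
  rewrite (swap _ (fun k n => `|g k n|)) => [|k n /g0 ->]; last exact: normr0.
  by apply: ler_sum => k _; exact: gM.
rewrite (_ : series _ = fun N => \sum_(k < N) series (g k : nat -> C) N) //.
apply/funext => N; rewrite /series /= big_mkord /fps_sum swap //.
by apply: eq_bigr => k _; rewrite big_mkord.
Qed.

Lemma tabs_cvg_bounded (f : tseries R[i]) s :
  tabs_cvg f s -> abs_bounded (dil f s) (tvalue_abs f s).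
Proof. by move=> fs N; apply: sum_le_limn => // k; exact: normr_ge0. Qed.

Lemma tabs_cvg_has_sum (f : tseries R[i]) s :
  tabs_cvg f s -> has_sum (dil f s) (tvalue f s).
Proof.
move=> /tabs_cvg_bounded fB; split; first by exists (tvalue_abs f s).
exact: (abs_bounded_cvgn fB).
Qed.

Lemma tderiv_has_sum (tau : tseries R[i]) z s : tderiv_abs_cvg tau z s ->
  let b k : C := z ^+ k.*2.+1 * tvalue (tderiv k.*2 tau) s in
  cvgn (series b) /\ has_sum (pderivs tau z s) (limn (series b)).
Proof.
move=> [ds cs] b.
have dB k := tabs_cvg_bounded (ds k).
have dB0 k : 0 <= tvalue_abs (tderiv k.*2 tau) s.
  by apply: le_trans (dB k 0%N); rewrite big_ord0.
apply: has_sum_fps_sum (fun k => abs_bounded_lamXM z k.*2.+1 (dB k)) _ _.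
- by move=> k n nk; rewrite fps_lamXM ifF //; apply/negbTE; lia.
- by move=> N; apply: sum_le_limn cs => k; rewrite mulr_ge0 // exprn_ge0.
- move=> k; apply: has_sumM; first exact/has_sumX/has_sum_lam.
  exact: (tabs_cvg_has_sum (ds k)).
Qed.

End ComplexSeries.

Lemma cvg_series_lincomb (K : numFieldType) (x y w : K) (u v s r : nat -> K)
    (lu lv ls : K) :
    series u @ \oo --> lu -> series v @ \oo --> lv -> series s @ \oo --> ls ->
    (forall k, r k = x * u k + y * v k - w * s k) ->
  series r @ \oo --> x * lu + y * lv - w * ls.
Proof.
move=> ul vl sl rE.
have -> : series r = fun N => x * series u N + y * series v N - w * series s N.
  apply/funext => N; rewrite /series /= !mulr_sumr -big_split -sumrB.
  by apply: eq_bigr => k _; rewrite rE.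
exact: (cvgB (cvgD (cvgM (cvg_cst x) ul) (cvgM (cvg_cst y) vl)) (cvgM (cvg_cst w) sl)).
Qed.

Unset Implicit Arguments.
Set Strict Implicit.
Set Printing Implicit Defensive.

(* Both identities are stated for formal power series, then between complex
   numbers wherever the expressions converge absolutely. *)
Theorem theorem1p2 (R : realType) (tau : tseries R[i]) (Htau : KdV_tau tau) :
  [/\ (forall (t : nat -> R[i]) (z1 z2 : R[i]),
        let T := dil tau in
        (lam z2 - lam z1) *
          (T (t + miwa z1 + miwa z2) * T (t - miwa z1) * T (t - miwa z2)
           - T (t - miwa z1 - miwa z2) * T (t + miwa z1) * T (t + miwa z2))
        = (lam z2 + lam z1) *
          (T (t + miwa z1 - miwa z2) * T (t - miwa z1) * T (t + miwa z2)
           - T (t - miwa z1 + miwa z2) * T (t + miwa z1) * T (t - miwa z2))),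
      (forall (t : nat -> R[i]) (z : R[i]),
        let T := dil tau in
        T (t + miwa z *+ 2) * T (t - miwa z) ^+ 2
          - T (t - miwa z *+ 2) * T (t + miwa z) ^+ 2
        = 2%:R * fps_sum (fun k => lam z ^+ k.*2.+1 *
            (T (t - miwa z) * W (@dil _) k.*2 tau t (t + miwa z)
             + T (t + miwa z) * W (@dil _) k.*2 tau t (t - miwa z)))),
      (forall (t : nat -> R[i]) (z1 z2 : R[i]),
        let T := tvalue tau in
        [/\ tabs_cvg tau (t + miwa z1), tabs_cvg tau (t - miwa z1),
            tabs_cvg tau (t + miwa z2) & tabs_cvg tau (t - miwa z2)] ->
        [/\ tabs_cvg tau (t + miwa z1 + miwa z2),
            tabs_cvg tau (t - miwa z1 - miwa z2),
            tabs_cvg tau (t + miwa z1 - miwa z2) &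
            tabs_cvg tau (t - miwa z1 + miwa z2)] ->
        (z2 - z1) *
          (T (t + miwa z1 + miwa z2) * T (t - miwa z1) * T (t - miwa z2)
           - T (t - miwa z1 - miwa z2) * T (t + miwa z1) * T (t + miwa z2))
        = (z2 + z1) *
          (T (t + miwa z1 - miwa z2) * T (t - miwa z1) * T (t + miwa z2)
           - T (t - miwa z1 + miwa z2) * T (t + miwa z1) * T (t - miwa z2))) &
      (forall (t : nat -> R[i]) (z : R[i]),
        let T := tvalue tau in
        [/\ tabs_cvg tau t, tabs_cvg tau (t + miwa z),
            tabs_cvg tau (t - miwa z), tabs_cvg tau (t + miwa z *+ 2) &
            tabs_cvg tau (t - miwa z *+ 2)] ->
        [/\ tderiv_abs_cvg tau z t, tderiv_abs_cvg tau z (t + miwa z) &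
            tderiv_abs_cvg tau z (t - miwa z)] ->
        let term (k : nat) : R[i] := z ^+ k.*2.+1 *
            (T (t - miwa z) * W (@tvalue _) k.*2 tau t (t + miwa z)
             + T (t + miwa z) * W (@tvalue _) k.*2 tau t (t - miwa z)) in
        cvgn (series (term : nat -> (R[i] : numFieldType))) /\
        T (t + miwa z *+ 2) * T (t - miwa z) ^+ 2
          - T (t - miwa z *+ 2) * T (t + miwa z) ^+ 2
        = 2%:R * limn (series (term : nat -> (R[i] : numFieldType))))].
Proof.
split=> [t z1 z2 T|t z T
  |t z1 z2 T [c1 c1' c2 c2'] [cA cB cC cD]
  |t z T [c0 cp cm cpp cmm] [d0 dp dm] term].
- exact: KdV_trilinear.
- by rewrite /T pderivs_W; exact: KdV_trilinear_diag.
(* [hl] and [hr] evaluate the two sides of the formal identity at $\lambda = 1$. *)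
- have hl := has_sumM (has_sumB (has_sum_lam z2) (has_sum_lam z1))
    (has_sumB (has_sumM (has_sumM (tabs_cvg_has_sum cA) (tabs_cvg_has_sum c1'))
                 (tabs_cvg_has_sum c2'))
       (has_sumM (has_sumM (tabs_cvg_has_sum cB) (tabs_cvg_has_sum c1))
          (tabs_cvg_has_sum c2))).
  have hr := has_sumM (has_sumD (has_sum_lam z2) (has_sum_lam z1))
    (has_sumB (has_sumM (has_sumM (tabs_cvg_has_sum cC) (tabs_cvg_has_sum c1'))
                 (tabs_cvg_has_sum c2))
       (has_sumM (has_sumM (tabs_cvg_has_sum cD) (tabs_cvg_has_sum c1))
          (tabs_cvg_has_sum c2'))).
  by move: hl; rewrite (KdV_trilinear Htau t z1 z2) => hl; exact: has_sum_unique hl hr.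
- have [cb0 h0] := tderiv_has_sum d0.
  have [cbp hp] := tderiv_has_sum dp.
  have [cbm hm] := tderiv_has_sum dm.
  set S0 := limn _ in h0; set Sp := limn _ in hp; set Sm := limn _ in hm.
  (* The sum of [term]: the sum over k is carried inside each W, where it turns the derivatives into
     S0, Sp and Sm. *)
  pose L := T (t - miwa z) * (T t * Sp - S0 * T (t + miwa z))
            + T (t + miwa z) * (T t * Sm - S0 * T (t - miwa z)).
  have termL : series (term : nat -> (R[i] : numFieldType)) @ \oo --> (L : (R[i] : numFieldType)).
    have expand1 (m p f x y w : R[i]) : m * (f * x - w * p) + p * (f * y - w * m)
        = m * f * x + p * f * y - (p * m + p * m) * w by ring.
    have expand (e m p f x y w : R[i]) : e * (m * (f * x - w * p) + p * (f * y - w * m))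
        = m * f * (e * x) + p * f * (e * y) - (p * m + p * m) * (e * w) by ring.
    rewrite (expand1 (T (t - miwa z)) (T (t + miwa z)) (T t) Sp Sm S0 : L = _).
    refine (@cvg_series_lincomb (R[i] : numFieldType) _ _ _ _ _ _ term _ _ _ cbp cbm cb0
      (fun k => _)).
    exact: (expand (z ^+ k.*2.+1) (T (t - miwa z)) (T (t + miwa z)) (T t)
      (tvalue (tderiv k.*2 tau) (t + miwa z)) (tvalue (tderiv k.*2 tau) (t - miwa z))
      (tvalue (tderiv k.*2 tau) t)).
  split; first exact: (cvgP _ termL).
  rewrite (norm_cvg_lim termL).
  have hl := has_sumB
    (has_sumM (tabs_cvg_has_sum cpp) (has_sumX 2 (tabs_cvg_has_sum cm)))
    (has_sumM (tabs_cvg_has_sum cmm) (has_sumX 2 (tabs_cvg_has_sum cp))).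
  have hL s s' Ss : has_sum (dil tau s) (T s) -> has_sum (dil tau s') (T s') ->
      has_sum (pderivs tau z s) Ss ->
      has_sum (dil tau s' * (dil tau t * pderivs tau z s - pderivs tau z t * dil tau s))
        (T s' * (T t * Ss - S0 * T s)).
    move=> hs hs' hSs; have h := tabs_cvg_has_sum c0.
    exact: has_sumM hs' (has_sumB (has_sumM h hSs) (has_sumM h0 hs)).
  have hp' := tabs_cvg_has_sum cp; have hm' := tabs_cvg_has_sum cm.
  have hr := has_sumD (hL _ _ _ hp' hm' hp) (hL _ _ _ hm' hp' hm).
  (* The factor 2 of the identity is handled as a sum of two equal terms. *)
  have {}hr := has_sumD hr hr.
  move: hl; rewrite (KdV_trilinear_diag Htau t z) mulr_natl mulr2n => hl.
  rewrite mulr_natl mulr2n; exact: has_sum_unique hl hr.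
Qed.
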